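(* Let $\mathsf{Pred}$ be a finite set of unary predicates, $S_1,\dots,S_n$ pairwise distinct state-descriptions over $\mathsf{Pred}$, and $\mathcal{V}\subseteq\mathbb{N}^n$. Then there is an $\mathcal{L}^2_\#$ sentence $\varphi$ in the predicates $\mathsf{Pred}$ such that for every finite model $\mathcal{M}$, $\mathcal{M}\models\varphi$ iff $(|S_1|_\mathcal{M},\dots,|S_n|_\mathcal{M})\in\mathcal{V}$, if and only if $\mathcal{V}$ is semi-linear. In other words, $\mathsf{MSO}^\phi(\#)$ defines exactly the numerical relations definable in Presburger Arithmetic (the first-order theory of $\langle\mathbb{N};+\rangle$).
   Context: $\mathcal{L}^2_\#$ is monadic second-order logic with equality over unary predicates: individual variables, monadic second-order variables ranging over all subsets of the domain, atoms $P(x)$, $X(x)$, $x=y$, Booleans, first- and second-order quantifiers, and count comparisons $\#_x\varphi\succsim\#_y\psi$ (arbitrarily nested), true iff $|\{d:\varphi\text{ holds with }x\mapsto d\}|\ge|\{d:\psi\text{ holds with }y\mapsto d\}|$. $\mathsf{MSO}^\phi(\#)$ is this logic over finite models. A state-description over $\mathsf{Pred}$ is $\bigwedge_{P\in J}P(x)\wedge\bigwedge_{P\notin J}\neg P(x)$, $J\subseteq\mathsf{Pred}$; $|S|_\mathcal{M}$ is the cardinality of its extension. A set $\mathcal{V}\subseteq\mathbb{N}^n$ is linear if it has the form $\{(b_1+\sum_{j\le m} a_{1,j}u_j,\dots,b_n+\sum_{j\le m} a_{n,j}u_j): u_1,\dots,u_m\in\mathbb{N}\}$ for fixed natural numbers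 $b_i,a_{i,j}$; semi-linear means a finite union of linear sets. *)

(* Defs.v *)
(* MathComp *)
From mathcomp Require Import all_boot.

Set Implicit Arguments.
Unset Strict Implicit.
Unset Printing Implicit Defensive.

(* Both object languages below use well-scoped de Bruijn indices: a variable in
   scope of k binders is an element of 'I_k, and a binder makes the new variable
   index 0 while shifting the others by one. *)
Definition env_cons (T : Type) (k : nat) (t : T) (e : {ffun 'I_k -> T}) :
  {ffun 'I_k.+1 -> T} := [ffun i => oapp e t (unlift ord0 i)].

Definition env_nil (T : Type) : {ffun 'I_0 -> T} := ffun0 (card_ord 0).

(* [form Pred k m] is the set of formulas with at most k free individual
   variables and m free monadic second-order variables; the remaining Boolean
   connectives and the universal quantifiers are definable.  [FCount f g] is
   #_x f >= #_y g, where x (resp. y) is the variable 0 of f (resp. g). *)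
Inductive form (Pred : Type) (k m : nat) : Type :=
| FPred of Pred & 'I_k
| FMem of 'I_m & 'I_k
| FEq of 'I_k & 'I_k
| FTop
| FNeg of form Pred k m
| FAnd of form Pred k m & form Pred k m
| FEx1 of form Pred k.+1 m
| FEx2 of form Pred k m.+1
| FCount of form Pred k.+1 m & form Pred k.+1 m.

Arguments FPred {Pred k m} P x.
Arguments FMem {Pred k m} X x.
Arguments FEq {Pred k m} x y.
Arguments FTop {Pred k m}.
Arguments FNeg {Pred k m} f.
Arguments FAnd {Pred k m} f g.
Arguments FEx1 {Pred k m} f.
Arguments FEx2 {Pred k m} f.
Arguments FCount {Pred k m} f g.

Definition sentence (Pred : Type) : Type := form Pred 0 0.

Record finmodel (Pred : Type) : Type := FinModel {
  domain : finType;
  domain_gt0 : 0 < #|domain|;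
  interp : Pred -> {set domain}
}.

(* Satisfaction is decidable since the domain is finite. *)
Fixpoint sat (Pred : Type) (M : finmodel Pred) (k m : nat) (f : form Pred k m) :
    {ffun 'I_k -> domain M} -> {ffun 'I_m -> {set domain M}} -> bool :=
  match f with
  | FPred P x => fun e _ => e x \in interp M P
  | FMem X x => fun e s => e x \in s X
  | FEq x y => fun e _ => e x == e y
  | FTop => fun _ _ => true
  | FNeg g => fun e s => ~~ sat g e s
  | FAnd g h => fun e s => sat g e s && sat h e s
  | FEx1 g => fun e s => [exists d : domain M, sat g (env_cons d e) s]
  | FEx2 g => fun e s => [exists A : {set domain M}, sat g e (env_cons A s)]
  | FCount g h => fun e s =>
      #|[set d : domain M | sat g (env_cons d e) s]| >=
      #|[set d : domain M | sat h (env_cons d e) s]|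
  end.

Definition models (Pred : Type) (M : finmodel Pred) (f : sentence Pred) : bool :=
  sat f (env_nil (domain M)) (env_nil {set domain M}).

Definition card_ext (Pred : Type) (M : finmodel Pred) (f : form Pred 1 0) : nat :=
  #|[set d : domain M |
      sat f (env_cons d (env_nil (domain M))) (env_nil {set domain M})]|.

(* Distinct J give distinct state-descriptions. *)
Definition state_description (Pred : finType) (J : {set Pred}) : form Pred 1 0 :=
  FAnd (\big[FAnd/FTop]_(P in J) FPred P ord0)
       (\big[FAnd/FTop]_(P | P \notin J) FNeg (FPred P ord0)).

Definition MSO_definable (Pred : finType) (n : nat) (S : 'I_n -> {set Pred})
    (V : {ffun 'I_n -> nat} -> Prop) : Prop :=
  exists f : sentence Pred, forall M : finmodel Pred,
    models M f <-> V [ffun i => card_ext M (state_description (S i))].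

Definition linear_set (n : nat) (V : {ffun 'I_n -> nat} -> Prop) : Prop :=
  exists (m : nat) (b : 'I_n -> nat) (a : 'I_n -> 'I_m -> nat),
    forall v, V v <->
      exists u : {ffun 'I_m -> nat},
        v = [ffun i => b i + \sum_(j < m) a i j * u j].

Definition semilinear_set (n : nat) (V : {ffun 'I_n -> nat} -> Prop) : Prop :=
  exists (r : nat) (L : 'I_r -> {ffun 'I_n -> nat} -> Prop),
    (forall l, linear_set (L l)) /\ (forall v, V v <-> exists l, L l v).

(* First-order formulas over <N; +>, with at most k free variables. *)
Inductive pterm (k : nat) : Type :=
| PVar of 'I_k
| PAdd of pterm k & pterm k.

Inductive pform (k : nat) : Type :=
| PEq of pterm k & pterm k
| PNeg of pform k
| PAnd of pform k & pform k
| PEx of pform k.+1.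

Fixpoint peval (k : nat) (e : {ffun 'I_k -> nat}) (t : pterm k) : nat :=
  match t with
  | PVar x => e x
  | PAdd t1 t2 => peval e t1 + peval e t2
  end.

Fixpoint psat (k : nat) (f : pform k) : {ffun 'I_k -> nat} -> Prop :=
  match f with
  | PEq t1 t2 => fun e => peval e t1 = peval e t2
  | PNeg g => fun e => ~ psat g e
  | PAnd g h => fun e => psat g e /\ psat h e
  | PEx g => fun e => exists d : nat, psat g (env_cons d e)
  end.

Definition Presburger_definable (n : nat) (V : {ffun 'I_n -> nat} -> Prop) : Prop :=
  exists f : pform n, forall v, V v <-> psat f v.

(* Main.v *)
(* A linear set is an affine image of N^m, and the solutions in N^K of a system
   of linear equations form a semilinear set because, by Dickson's lemma, they are
   generated by finitely many minimal ones.  Hence semilinear sets are closed under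
   intersection and contain the solution sets of linear inequalities and of
   congruences, so every quantifier-free combination of such atoms is semilinear.
   Quantifier-free sets are closed under projection: if x is minimal with V(x),
   then either x is smaller than the period L of the congruences or the truth
   value of an inequality a x + t >= 0 changes between x - L and x, which leaves
   finitely many candidates for a x + t.
   Presburger formulas therefore define semilinear sets.  So do formulas of MSO
   with counting: whether one holds depends only on the number of elements of each
   type, a set quantifier splits these numbers, and a count comparison compares
   two subsums of them.
   Conversely, v = b + sum_j u_j a_j holds iff the extensions of the state
   descriptions split into b_i singletons and, for every j, blocks of a common
   size u_j, a_ij of them in the i-th extension. *)
Require Import Defs.
From Stdlib Require Import Classical.
From mathcomp Require Import all_boot order ssralg ssrnum ssrint intdiv zify.

Set Implicit Arguments.
Unset Strict Implicit.
Unset Printing Implicit Defensive.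

Import Order.TTheory GRing.Theory Num.Theory.

(** * Semilinear sets *)

Notation vec K := {ffun K -> nat} (only parsing).

Section LinearCombinations.
Local Open Scope ring_scope.
Variable K : finType.

(** With vectors as [M] this is the periodic part of a linear set, with integers it is a linear
    form. *)
Definition lcomb (M : nmodType) (a : K -> M) (u : vec K) : M :=
  \sum_k a k *+ u k.

Variable M : nmodType.
Implicit Types (a : K -> M) (u : vec K).

Lemma lcomb0 a : lcomb a 0 = 0.
Proof. by rewrite /lcomb big1 // => k _; rewrite ffunE. Qed.

Lemma lcombD a u v : lcomb a (u + v) = lcomb a u + lcomb a v.
Proof.
by rewrite /lcomb -big_split; apply: eq_bigr => k _; rewrite ffunE mulrnDr.
Qed.

Definition unitv (j : K) : vec K := [ffun k => (k == j) : nat].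

Lemma lcomb_unitv a j : lcomb a (unitv j) = a j.
Proof.
rewrite /lcomb (bigD1 j) //= big1 ?addr0 => [|k /negbTE kj];
by rewrite ffunE ?eqxx ?kj.
Qed.

End LinearCombinations.

(** * The pointwise order on vectors and Dickson's lemma *)

Section Vectors.
Local Open Scope ring_scope.
Variable K : finType.
Implicit Types (u v : vec K).

Lemma vec_addI v : injective (+%R v).
Proof.
move=> x y /ffunP xy; apply/ffunP => k; have := xy k.
by rewrite !ffunE => /addnI.
Qed.

Lemma vec_leP (u v : vec K) : (forall k, (u k <= v k)%N) -> {w | v = u + w}.
Proof.
move=> uv; exists [ffun k => (v k - u k)%N].
by apply/ffunP => k; rewrite !ffunE; exact/esym/subnKC.
Qed.

Lemma vec_neq0 v : v != 0 -> exists k, (0 < v k)%N.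
Proof.
move=> v0; apply/existsP; apply: contraNT v0 => /existsPn h.
by apply/eqP/ffunP => k; have := h k; rewrite ffunE lt0n negbK => /eqP.
Qed.

(** Induction on the list of coordinates compared. A basis [B] for the old coordinates still serves
    every [x] whose new coordinate is at least the maximum [N] of those in [B]. The elements below
    [N] fall into finitely many slices of constant new coordinate, and each slice has its own basis
    by induction. *)
Lemma dickson (P : vec K -> Prop) : exists B : seq (vec K),
  (forall b, b \in B -> P b) /\
  (forall x, P x -> exists2 b, b \in B & forall k, (b k <= x k)%N).
Proof.
suff: exists B : seq (vec K), (forall b, b \in B -> P b) /\
    (forall x, P x -> exists2 b, b \in B & {in enum K, forall k, (b k <= x k)%N}).
  move=> [B [BP hB]]; exists B; split => // x /hB [b bB bx].
  by exists b => // k; apply: bx; rewrite mem_enum.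
elim: (enum K) P => [|k s IH] P.
  have [[x Px]|nP] := classic (exists x, P x).
    exists [:: x]; split=> [b|y _]; first by rewrite inE => /eqP ->.
    by exists x => //; rewrite mem_head.
  by exists [::]; split=> // x Px; case: nP; exists x.
have [B [BP hB]] := IH P.
pose N := \max_(b <- B) b k.
have [C [CP hC]] : exists C : seq (vec K), (forall b, b \in C -> P b) /\
    (forall x, P x -> (x k < N)%N ->
       exists2 b, b \in C & {in k :: s, forall k, (b k <= x k)%N}).
  elim: N => [|N [C [CP hC]]]; first by exists [::].
  have [D [DP hD]] := IH (fun x => P x /\ x k = N).
  exists (C ++ D); split=> [b|x Px].
    by rewrite mem_cat => /orP[/CP|/DP[]].
  rewrite ltnS leq_eqVlt => /orP[/eqP xN|xN].
    have [b bD bx] := hD x (conj Px xN); exists b; first by rewrite mem_cat bD orbT.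
    have [_ bN] := DP _ bD.
    by move=> l; rewrite inE => /predU1P[->|/bx //]; rewrite bN xN.
  by have [b bC bx] := hC x Px xN; exists b => //; rewrite mem_cat bC.
exists (B ++ C); split=> [b|x Px].
  by rewrite mem_cat => /orP[/BP|/CP].
have [xN|Nx] := ltnP (x k) N.
  by have [b bC bx] := hC x Px xN; exists b => //; rewrite mem_cat bC orbT.
have [b bB bx] := hB x Px; exists b; first by rewrite mem_cat bB.
move=> l; rewrite inE => /predU1P[->|/bx //].
by apply: leq_trans Nx; rewrite /N (big_rem b) //= leq_maxl.
Qed.

End Vectors.

(** * Closure properties of semilinear sets *)

Section Semilinear.
Local Open Scope ring_scope.

(** An inductive form of semilinearity over any finite index type. The constructor [slin_ext] gives
    invariance under pointwise equivalence without an extensionality axiom. *)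
Inductive slin (K : finType) : (vec K -> Prop) -> Prop :=
| slin_lin m (b : vec K) (a : 'I_m -> vec K) :
    slin (fun v => exists u, v = b + lcomb a u)
| slin_false : slin (fun=> False)
| slin_or V W : slin V -> slin W -> slin (fun v => V v \/ W v)
| slin_ext V W : (forall v, V v <-> W v) -> slin V -> slin W.

Lemma slin_exists (K : finType) (I : finType) (V : I -> vec K -> Prop) :
  (forall i, slin (V i)) -> slin (fun v => exists i, V i v).
Proof.
move=> slV.
suff: slin (fun v => exists2 i, i \in enum I & V i v).
  apply: slin_ext => v; split=> [[i _ Vi]|[i Vi]]; exists i => //.
  by rewrite mem_enum.
elim: (enum I) => [|i s IH].
  by apply: slin_ext (slin_false K) => v; split=> // -[].
apply: slin_ext (slin_or (slV i) IH) => v; split.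
  case=> [Vi|[l ls Vl]]; first by exists i; rewrite ?mem_head.
  by exists l => //; rewrite inE ls orbT.
by case=> l; rewrite inE => /predU1P[->|ls] Vl; [left | right; exists l].
Qed.

(* The minimal elements of [T] serve as offsets and the minimal nonzero elements
   of [H] as periods; both are finite in number by Dickson's lemma. *)
Lemma slin_stable (K : finType) (T H : vec K -> Prop) : H 0 ->
  (forall h x, H h -> (H (h + x) <-> H x)) ->
  (forall t x, T t -> (T (t + x) <-> H x)) -> slin T.
Proof.
move=> H0 HH TH.
have [B [BT hB]] := dickson T.
have [C [CH hC]] := dickson (fun h => H h /\ h != 0).
pose a (j : 'I_(size C)) := C`_j.
have aH j : H (a j) by case: (CH (a j)) => //; rewrite mem_nth.
(* [H] is the monoid generated by [C]: subtracting from a nonzero [x] an element of [C] below it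
   stays in [H] and lowers the sum of the coordinates. *)
have HP x : H x <-> exists u, x = lcomb a u.
  split.
    have [n] := ubnP (\sum_k x k); elim: n x => // n IH x xn Hx.
    have [->|x0] := eqVneq x 0; first by exists 0; rewrite lcomb0.
    have [c cC cx] := hC x (conj Hx x0); have [Hc c0] := CH c cC.
    have [y xE] := vec_leP cx; rewrite xE in xn Hx *.
    have [||u ->] := IH y; first 1 last.
    - exact/(HH _ _ Hc).
    - exists (unitv (Ordinal (etrans (index_mem c C) cC)) + u).
      by rewrite lcombD lcomb_unitv /a nth_index.
    - have [k ck] := vec_neq0 c0.
      move: xn; rewrite ltnS; apply: leq_trans.
      rewrite [X in (_ < X)%N](eq_bigr (fun k => c k + y k)%N) => [|i _];
        last by rewrite ffunE.
      rewrite big_split /= -[X in (X < _)%N]add0n ltn_add2r.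
      by rewrite (bigD1 k) //= addn_gt0 ck.
  case=> u ->; rewrite /lcomb; elim/big_ind: _ => // [y z Hy Hz|j _].
    exact/(HH _ _ Hy).
  elim: (u j) => // n Hn; rewrite mulrS; exact/(HH _ _ (aH j)).
suff: slin (fun v => exists i : 'I_(size B), exists u, v = B`_i + lcomb a u).
  apply: slin_ext => v; split=> [[i [u ->]]|Tv].
    by apply/TH; [apply: BT; rewrite mem_nth | apply/HP; exists u].
  have [b bB /vec_leP [w vE]] := hB v Tv; subst v.
  have /TH -/(_ w)/iffLR/(_ Tv)/HP [u ->] := BT _ bB.
  exists (Ordinal (etrans (index_mem b B) bB)), u.
  by rewrite nth_index.
by apply: slin_exists => i; apply: slin_lin.
Qed.

Lemma slin_image (K I : finType) (V : vec K -> Prop) (b : vec I)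
    (f : vec K -> vec I) : f 0 = 0 -> {morph f : x y / x + y} ->
  slin V -> slin (fun w => exists2 u, V u & w = b + f u).
Proof.
move=> f0 fD.
have fM x n : f (x *+ n) = f x *+ n.
  by elim: n => // n IH; rewrite !mulrS fD IH.
elim=> {V} [m c a||V W _ slV _ slW|V W VW _].
- apply: slin_ext (slin_lin (b + f c) (f \o a)) => v.
  have fE u : f (c + lcomb a u) = f c + lcomb (f \o a) u.
    rewrite fD /lcomb (big_morph f fD f0); congr (_ + _).
    by apply: eq_bigr => j _; rewrite fM.
  split=> [[u ->]|[w [u ->] ->]].
    by exists (c + lcomb a u); [exists u | rewrite fE addrA].
  by exists u; rewrite fE addrA.
- by apply: slin_ext (slin_false I) => v; split=> // -[].
- apply: slin_ext (slin_or slV slW) => v; split.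
    by case=> -[u Vu ->]; exists u => //; [left | right].
  by case=> u [Vu|Wu] ->; [left | right]; exists u.
- by apply: slin_ext => v; split=> -[u /VW Vu ->]; exists u.
Qed.

(** For two linear sets, the pairs of coefficient vectors that yield the same point solve a linear
    system. Its solution set is stable under the homogeneous solutions, hence semilinear, and the
    intersection is an affine image of it. *)
Lemma slin_and (K : finType) (V W : vec K -> Prop) :
  slin V -> slin W -> slin (fun v => V v /\ W v).
Proof.
move=> slV; elim: slV W => {V} [m b a||V1 V2 _ IH1 _ IH2|V1 V2 V12 _ IH] W slW.
- elim: slW => {W} [m' b' a'||W1 W2 _ IH1 _ IH2|W1 W2 W12 _].
  + pose l (u : vec ('I_m + 'I_m')%type) : vec 'I_m := [ffun j => u (inl j)].
    pose r (u : vec ('I_m + 'I_m')%type) : vec 'I_m' := [ffun j => u (inr j)].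
    have l0 : l 0 = 0 by apply/ffunP => j; rewrite !ffunE.
    have r0 : r 0 = 0 by apply/ffunP => j; rewrite !ffunE.
    have lD : {morph l : x y / x + y} by move=> x y; apply/ffunP => j; rewrite !ffunE.
    have rD : {morph r : x y / x + y} by move=> x y; apply/ffunP => j; rewrite !ffunE.
    have slT : slin (fun u => b + lcomb a (l u) = b' + lcomb a' (r u)).
      apply: (@slin_stable _ _ (fun u => lcomb a (l u) = lcomb a' (r u))).
      * by rewrite l0 r0 !lcomb0.
      * move=> h x hh; rewrite lD rD !lcombD hh.
        by split=> [/vec_addI //|->].
      * move=> t x ht; rewrite lD rD !lcombD !addrA ht.
        by split=> [/vec_addI //|->].
    have := @slin_image _ _ _ b (lcomb a \o l) _ _ slT.
    rewrite /= l0 lcomb0 => /(_ erefl) slI.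
    apply: slin_ext (slI _) => [v|x y /=]; last by rewrite lD lcombD.
    split=> [[u Tu ->]|[[u1 vE] [u2 vE2]]].
      by split; [exists (l u) | rewrite Tu; exists (r u)].
    pose u := [ffun j => match j with inl x => u1 x | inr y => u2 y end] : vec ('I_m + 'I_m')%type.
    have lu : l u = u1 by apply/ffunP => j; rewrite !ffunE.
    have ru : r u = u2 by apply/ffunP => j; rewrite !ffunE.
    by exists u; rewrite lu ?ru // -vE -vE2.
  + by apply: slin_ext (slin_false K) => v; tauto.
  + by apply: slin_ext (slin_or IH1 IH2) => v; tauto.
  + by apply: slin_ext => v; rewrite W12.
- by apply: slin_ext (slin_false K) => v; tauto.
- by apply: slin_ext (slin_or (IH1 W slW) (IH2 W slW)) => v; tauto.
- by apply: slin_ext (IH W slW) => v; rewrite V12.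
Qed.

Lemma semilinear_set_or n (V W : vec 'I_n -> Prop) :
  semilinear_set V -> semilinear_set W -> semilinear_set (fun v => V v \/ W v).
Proof.
move=> [r [L [linL VL]]] [r' [L' [linL' WL']]].
exists (r + r')%N, (fun l => match split l with inl x => L x | inr y => L' y end).
split=> [l|v]; first by case: split.
split.
  case=> [/VL [l Ll]|/WL' [l Ll]].
    by exists (unsplit (inl l)); rewrite unsplitK.
  by exists (unsplit (inr l)); rewrite unsplitK.
by case=> l; case: split => j Lj; [left; apply/VL; exists j | right; apply/WL'; exists j].
Qed.

Lemma lcombE n m (b : vec 'I_n) (a : 'I_m -> vec 'I_n) u :
  b + lcomb a u = [ffun i => (b i + \sum_(j < m) a j i * u j)%N].
Proof.
apply/ffunP => i; rewrite !ffunE sum_ffunE; congr addn.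
by apply: eq_bigr => j _; rewrite ffunMnE -mulr_natr natn.
Qed.

Lemma semilinear_slin n (V : vec 'I_n -> Prop) : slin V -> semilinear_set V.
Proof.
elim=> {V} [m b a||V W _ slV _ slW|V W VW _ [r [L [linL VL]]]].
- exists 1, (fun _ v => exists u, v = b + lcomb a u); split=> [_|v].
    exists m, b, (fun i j => a j i) => v.
    by split=> -[u ->]; exists u; rewrite lcombE.
  by split=> [|[]] //; exists ord0.
- by exists 0, (fun _ _ => False); split=> [[]//|v]; split=> // -[].
- exact: semilinear_set_or.
- by exists r, L; split=> // v; rewrite -VW.
Qed.

End Semilinear.

(** * Quantifier-free sets *)

Section QuantifierFree.
Local Open Scope ring_scope.

Definition aeval (K : finType) (p : {ffun K -> int} * int) (v : vec K) : int :=
  lcomb p.1 v + p.2.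

Definition affine (K : finType) (f : vec K -> int) : Prop :=
  exists p, forall v, f v = aeval p v.

Section Affine.
Variable K : finType.
Implicit Types (f g : vec K -> int) (v : vec K).

Lemma affine_cst c : affine (fun _ : vec K => c).
Proof.
exists (0, c) => v; rewrite /aeval /lcomb big1 ?add0r // => k _.
by rewrite ffunE mul0rn.
Qed.

Lemma affine_coord k : affine (fun v => (v k)%:Z).
Proof.
exists ([ffun l => (l == k)%:Z], 0) => v.
rewrite /aeval /lcomb addr0 (bigD1 k) //= big1 ?ffunE ?eqxx ?addr0.
  by rewrite -mulr_natl natz mulr1.
by move=> l /negbTE lk; rewrite ffunE lk mul0rn.
Qed.

Lemma affineD f g : affine f -> affine g -> affine (fun v => f v + g v).
Proof.
move=> [p fE] [q gE]; exists ([ffun k => p.1 k + q.1 k], p.2 + q.2) => v.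
rewrite fE gE /aeval addrACA; congr (_ + _).
by rewrite /lcomb -big_split; apply: eq_bigr => k _; rewrite ffunE mulrnDl.
Qed.

Lemma affineZ c f : affine f -> affine (fun v => c * f v).
Proof.
move=> [p fE]; exists ([ffun k => c * p.1 k], c * p.2) => v.
rewrite fE /aeval mulrDr; congr (_ + _).
by rewrite /lcomb mulr_sumr; apply: eq_bigr => k _; rewrite ffunE mulrnAr.
Qed.

Lemma affineN f : affine f -> affine (fun v => - f v).
Proof.
by move=> /(affineZ (-1)) [p fE]; exists p => v; rewrite -fE mulN1r.
Qed.

Lemma affine_sum (I : Type) (r : seq I) (P : pred I) (F : I -> vec K -> int) :
  (forall i, affine (F i)) -> affine (fun v => \sum_(i <- r | P i) F i v).
Proof.
move=> aF; elim: r => [|i r IH].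
  by have [p pE] := affine_cst 0; exists p => v; rewrite big_nil -pE.
have [[p pE] [q qE]] := (IH, affineD (aF i) IH).
by case: (boolP (P i)) => Pi; [exists q | exists p] => v;
  rewrite big_cons ?Pi ?(negbTE Pi).
Qed.

Lemma affine_if (b : bool) f g :
  affine f -> affine g -> affine (fun v => if b then f v else g v).
Proof. by case: b. Qed.

End Affine.

(** Substitution with a common denominator [a]: solving [a * x = t] for a variable makes only the
    multiple [a * x] affine in the others. *)
Lemma affine_comp (K I : finType) (f : vec K -> int) (a : int)
    (F : K -> vec I -> int) :
  affine f -> (forall k, affine (F k)) ->
  exists2 g, affine g & forall v (u : vec K), (forall k, a * (u k)%:Z = F k v) ->
    a * f u = g v.
Proof.
move=> [p fE] aF; exists (fun v => \sum_k p.1 k * F k v + a * p.2).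
  apply: affineD (affine_cst _ _).
  by apply: affine_sum => k; apply: affineZ.
move=> v u uF; rewrite fE /aeval mulrDr; congr (_ + _).
rewrite /lcomb mulr_sumr; apply: eq_bigr => k _.
by rewrite -uF [RHS]mulrCA -mulr_natr natz.
Qed.

(** The divisibility atoms keep the class closed under projection: for instance
    [exists x, 2 * x = v k] says that [v k] is even. *)
Inductive qf (K : finType) : (vec K -> Prop) -> Prop :=
| qf_ge0 (f : vec K -> int) : affine f -> qf (fun v => 0 <= f v)
| qf_dvd m (f : vec K -> int) : (0 < m)%N -> affine f -> qf (fun v => (m%:Z %| f v)%Z)
| qf_not V : qf V -> qf (fun v => ~ V v)
| qf_and V W : qf V -> qf W -> qf (fun v => V v /\ W v)
| qf_ext V W : (forall v, V v <-> W v) -> qf V -> qf W.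

Section QfTheory.
Variable K : finType.
Implicit Types (V W : vec K -> Prop) (f g : vec K -> int).

Lemma qf_or V W : qf V -> qf W -> qf (fun v => V v \/ W v).
Proof.
move=> qV qW; apply: qf_ext (qf_not (qf_and (qf_not qV) (qf_not qW))) => v.
tauto.
Qed.

Lemma qf_iff V W : qf V -> qf W -> qf (fun v => V v <-> W v).
Proof.
move=> qV qW.
apply: qf_ext (qf_or (qf_and qV qW) (qf_and (qf_not qV) (qf_not qW))) => v.
tauto.
Qed.

Lemma qf_true : qf (fun _ : vec K => True).
Proof. by apply: qf_ext (qf_ge0 (affine_cst _ 0)). Qed.

Lemma qf_prop (P : Prop) : qf (fun _ : vec K => P).
Proof.
have [p|np] := classic P; first by apply: qf_ext qf_true.
by apply: qf_ext (qf_not qf_true) => v; split.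
Qed.

Lemma qf_eq f g : affine f -> affine g -> qf (fun v => f v = g v).
Proof.
move=> af ag.
have h1 := qf_ge0 (affineD af (affineN ag)).
have h2 := qf_ge0 (affineD ag (affineN af)).
by apply: qf_ext (qf_and h1 h2) => v; rewrite /=; split; [case|]; lia.
Qed.

Lemma qf_exists_in (T : eqType) (s : seq T) (V : T -> vec K -> Prop) :
  (forall i, i \in s -> qf (V i)) -> qf (fun v => exists2 i, i \in s & V i v).
Proof.
elim: s => [|i s IH] qV.
  by apply: qf_ext (qf_prop False) => v; split=> // -[].
have qs : qf (fun v => exists2 l, l \in s & V l v).
  by apply: IH => l ls; apply: qV; rewrite inE ls orbT.
apply: qf_ext (qf_or (qV i (mem_head _ _)) qs) => v; split.
  case=> [Vi|[l ls Vl]]; first by exists i; rewrite ?mem_head.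
  by exists l => //; rewrite inE ls orbT.
by case=> l; rewrite inE => /predU1P[->|ls] Vl; [left | right; exists l].
Qed.

Lemma qf_exists (I : finType) (V : I -> vec K -> Prop) :
  (forall i, qf (V i)) -> qf (fun v => exists i, V i v).
Proof.
move=> qV; have := @qf_exists_in I (enum I) V (fun i _ => qV i).
apply: qf_ext => v; split=> [[i _ Vi]|[i Vi]]; exists i => //.
by rewrite mem_enum.
Qed.

Lemma qf_forall (I : finType) (V : I -> vec K -> Prop) :
  (forall i, qf (V i)) -> qf (fun v => forall i, V i v).
Proof.
move=> qV; apply: qf_ext (qf_not (qf_exists (fun i => qf_not (qV i)))) => v.
split=> [h i|h [i]]; last exact.
by apply: NNPP => nV; apply: h; exists i.
Qed.

End QfTheory.

(** The extra coordinate [None] is a slack variable. It turns the inequality into an equation, whose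
    solutions form a stable set, and [r] forgets it again. *)
Lemma slin_ge0 (K : finType) (f : vec K -> int) :
  affine f -> slin (fun v => 0 <= f v).
Proof.
move=> [[a c] fE].
pose r (u : vec (option K)) : vec K := [ffun k => u (Some k)].
have r0 : r 0 = 0 by apply/ffunP => j; rewrite !ffunE.
have rD : {morph r : x y / x + y} by move=> x y; apply/ffunP => j; rewrite !ffunE.
have slT : slin (fun u => lcomb a (r u) + c = (u None)%:Z).
  apply: (@slin_stable _ _ (fun u => lcomb a (r u) = (u None)%:Z)).
  - by rewrite r0 lcomb0 ffunE.
  - by move=> h x hh; rewrite rD lcombD hh ffunE PoszD; split=> [/addrI//|->].
  - by move=> t x tt; rewrite rD lcombD ffunE PoszD -tt addrAC; split=> [/addrI//|->].
apply: slin_ext (slin_image 0 r0 rD slT) => v; split.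
  by case=> u hu ->; rewrite add0r fE /aeval /= hu.
rewrite fE /aeval /= => fv.
pose u : vec (option K) :=
  [ffun o => if o is Some k then v k else `|(lcomb a v + c : int)|%N].
have ru : r u = v by apply/ffunP => k; rewrite !ffunE.
by exists u; rewrite ?add0r ru // ffunE gez0_abs.
Qed.

Lemma slin_dvd (K : finType) (m : nat) (f : vec K -> int) :
  affine f -> slin (fun v => (m%:Z %| f v)%Z).
Proof.
move=> [[a c] fE].
apply: (@slin_stable _ _ (fun u => (m%:Z %| lcomb a u)%Z)).
- by rewrite lcomb0 dvdz0.
- by move=> h x hh; rewrite lcombD (rpredDl _ hh).
- move=> t x; rewrite !fE /aeval lcombD addrAC => tt.
  by rewrite (rpredDl _ tt).
Qed.

(** Negation is handled by carrying the set and its complement through the induction together; only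
    the atoms then need a complement computed by hand. *)
Lemma slin_qf (K : finType) (V : vec K -> Prop) : qf V -> slin V.
Proof.
suff: qf V -> slin V /\ slin (fun v => ~ V v) by move=> h /h [].
elim=> {V} [f af|m f m0 af|V _ [pV nV]|V W _ [pV nV] _ [pW nW]|V W VW _ [pV nV]].
- split; first exact: slin_ge0.
  have := slin_ge0 (affineD (affineN af) (affine_cst _ (-1))).
  by apply: slin_ext => v; rewrite /=; split; lia.
- split; first exact: slin_dvd.
  (* [m] does not divide [f v] iff it divides [f v + c] for some [c] from 1 to [m - 1]; the witness
     is [m] minus the remainder of [f v], and [i] is [c - 1]. *)
  have := slin_exists (fun i : 'I_m.-1 =>
            slin_dvd m (affineD af (affine_cst _ (i.+1)%:Z))).
  apply: slin_ext => v; split=> [[i] /=|h].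
    move=> h hf; move: h; rewrite (rpredDl _ hf) dvdzE /= gtnNdvd //.
    by have := ltn_ord i; lia.
  have rm : (f v %% m%:Z)%Z < m%:Z by rewrite ltz_pmod.
  have r0 : 0 <= (f v %% m%:Z)%Z by rewrite modz_ge0 // -lt0n.
  have rn : (f v %% m%:Z)%Z != 0 by apply/negP => /eqP/dvdz_mod0P.
  have im : (m - `|(f v %% m%:Z)%Z|.+1 < m.-1)%N by lia.
  exists (Ordinal im) => /=.
  rewrite {1}(divz_eq (f v) m).
  rewrite [X in (_ %| X)%Z](_ : _ = ((f v %/ m%:Z)%Z + 1) * m%:Z) ?dvdz_mull //.
  by rewrite mulrDl mul1r -addrA; congr (_ + _); lia.
- split=> //; apply: slin_ext pV => v; tauto.
- split; first exact: slin_and.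
  apply: slin_ext (slin_or nV nW) => v; tauto.
- split; first exact: slin_ext pV.
  by apply: slin_ext nV => v; rewrite VW.
Qed.

(** Multiplying an atom by [a] makes it a condition on [v]: the sign is unchanged since [a] is
    positive, and [m] divides [f u] iff [a * m] divides [a * f u]. *)
Lemma qf_subst (K I : finType) (V : vec K -> Prop) (a : nat)
    (F : K -> vec I -> int) :
  qf V -> (0 < a)%N -> (forall k, affine (F k)) ->
  exists2 W, qf W & forall v (u : vec K), (forall k, a%:Z * (u k)%:Z = F k v) ->
    (V u <-> W v).
Proof.
move=> qV a0 aF; elim: qV => {V}
  [f af|m f m0 af|V _ [W qW VW]|V V' _ [W qW VW] _ [W' qW' VW']|V V' VV' _ [W qW VW]].
- have [g ag gE] := affine_comp a af aF.
  exists (fun v => 0 <= g v); first exact: qf_ge0.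
  by move=> v u /gE <-; rewrite pmulr_rge0.
- have [g ag gE] := affine_comp a af aF.
  exists (fun v => ((a * m)%N%:Z %| g v)%Z); first by apply: qf_dvd; rewrite ?muln_gt0 ?a0.
  by move=> v u /gE <-; rewrite PoszM dvdz_mul2l // -lt0n.
- by exists (fun v => ~ W v); [exact: qf_not | move=> v u /VW ->].
- exists (fun v => W v /\ W' v); first exact: qf_and.
  by move=> v u h; rewrite (VW _ _ h) (VW' _ _ h).
- by exists W => // v u /VW <-; rewrite VV'.
Qed.

Lemma qf_comp (K I : finType) (V : vec K -> Prop) (F : vec I -> vec K) :
  qf V -> (forall k, affine (fun v => (F v k)%:Z)) -> qf (fun v => V (F v)).
Proof.
move=> qV aF; have [W qW VW] := qf_subst qV (isT : (0 < 1)%N) aF.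
by apply: qf_ext qW => v; rewrite -(VW v (F v)) // => k; rewrite mul1r.
Qed.

End QuantifierFree.

(** * Quantifier elimination *)

Section Elimination.
Local Open Scope ring_scope.
Variable K : finType.
Implicit Types (V W : vec K -> Prop) (u v : vec K).

Definition upd v (j : K) (x : nat) : vec K :=
  [ffun k => if k == j then x else v k].

Lemma aeval_upd p v j x :
  aeval p (upd v j x) = aeval p (upd v j 0) + p.1 j * x%:Z.
Proof.
rewrite /aeval addrAC; congr (_ + _).
rewrite /lcomb (bigD1 j) //= [X in _ = X + _](bigD1 j) //=.
rewrite !ffunE eqxx mulr0n add0r addrC -mulr_natr natz; congr (_ + _).
by apply: eq_bigr => k /negbTE kj; rewrite !ffunE kj.
Qed.

(* Along coordinate [j] the set [V] is periodic with period [L], except near the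
   zeros of the linear forms occurring in it. *)
Lemma qf_break j V : qf V ->
  exists2 L, (0 < L)%N & forall L', (0 < L')%N -> (L %| L')%N ->
  exists2 B : seq (nat * ({ffun K -> int} * int)),
    forall p, p \in B -> (0 < p.1)%N &
    forall v x, (V (upd v j (x + L')) <-> V (upd v j x)) \/
      (exists2 p, p \in B & p.1%:Z * (x + L')%:Z = aeval p.2 (upd v j 0)).
Proof.
elim=> {V} [f [p fE]|m f m0 [p fE]|V _ [L L0 hL]|V W _ [L L0 hL] _ [L1 L10 hL1]|V W VW _ [L L0 hL]].
- exists 1%N => // L L0 _.
  have [pj0|pj0] := eqVneq (p.1 j) 0.
    exists [::] => // v x; left.
    by rewrite !fE !(aeval_upd _ _ _ (_ + _)) (aeval_upd _ _ _ x) pj0 !mul0r.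
  (* Write the form as [y + a x]. If its sign condition changes between [x] and [x + L], then
     [|a| (x + L)] is [- sgz a * y + i], where [i] is the absolute value of the form at [x + L] and
     is at most [|a| L]. The [q i] list these right-hand sides. *)
  pose q (i : nat) : {ffun K -> int} * int :=
    ([ffun k => - sgz (p.1 j) * p.1 k], - sgz (p.1 j) * p.2 + i%:Z).
  exists [seq (absz (p.1 j), q i) | i <- iota 0 (absz (p.1 j) * L).+1].
    by move=> _ /mapP [i _ ->] /=; rewrite absz_gt0.
  move=> v x; rewrite !fE (aeval_upd _ _ _ (_ + _)) (aeval_upd _ _ _ x).
  have qE i : aeval (q i) (upd v j 0) = - sgz (p.1 j) * aeval p (upd v j 0) + i%:Z.
    rewrite /aeval /= addrA mulrDr; congr (_ + _ + _).
    rewrite /lcomb mulr_sumr; apply: eq_bigr => k _.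
    by rewrite !ffunE mulrnAr.
  move: (aeval p _) (p.1 j : int) pj0 q qE => y a pj0 q qE.
  suff: ((0 <= y + a * (x + L)%:Z) <-> (0 <= y + a * x%:Z)) \/
      exists2 i, (i <= absz a * L)%N & (absz a)%:Z * (x + L)%:Z = - sgz a * y + i%:Z.
    case=> [|[i iL hi]]; first by left.
    right; exists (absz a, q i); last by rewrite /= qE.
    by apply/mapP; exists i; rewrite // mem_iota.
  have -> : (x + L)%:Z = x%:Z + L%:Z by [].
  have -> : (absz a * L)%N = absz (a * L%:Z) by rewrite abszM.
  rewrite abszE !mulrDr.
  have [a0|a0] : 0 < a \/ a < 0 by lia.
    rewrite gtr0_sgz // gtr0_norm //.
    have : 0 <= a * L%:Z by rewrite mulr_ge0 // ltW.
    move: (a * L%:Z) (a * x%:Z) => c b c0.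
    have [h1|h1] : 0 <= y + b \/ y + b < 0 by lia.
      by left; lia.
    have [h2|h2] : y + (b + c) < 0 \/ 0 <= y + (b + c) by lia.
      by left; lia.
    by right; exists (absz (y + (b + c))); lia.
  rewrite ltr0_sgz // ltr0_norm // !mulNr opprK.
  have : a * L%:Z <= 0 by rewrite mulr_le0_ge0 // ltW.
  move: (a * L%:Z) (a * x%:Z) => c b c0.
  have [h1|h1] : y + b < 0 \/ 0 <= y + b by lia.
    by left; lia.
  have [h2|h2] : 0 <= y + (b + c) \/ y + (b + c) < 0 by lia.
    by left; lia.
  by right; exists (absz (y + (b + c))); lia.
- exists m => // L L0 mL; exists [::] => // v x; left.
  rewrite !fE (aeval_upd _ _ _ (_ + _)) (aeval_upd _ _ _ x) PoszD mulrDr addrA.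
  have hL : (m%:Z %| p.1 j * L%:Z)%Z by rewrite dvdz_mull.
  by rewrite (rpredDr _ hL).
- exists L => // L' L'0 /(hL _ L'0) [B B0 hB]; exists B => // v x.
  by have [VV|] := hB v x; [left; rewrite VV | right].
(* Both sets have to be compared along one common step [L']; this is why all multiples of a period
   are allowed. *)
- exists (L * L1)%N; first by rewrite muln_gt0 L0.
  move=> L' L'0 LL.
  have [B B0 hB] := hL _ L'0 (dvdn_trans (dvdn_mulr _ (dvdnn _)) LL).
  have [C C0 hC] := hL1 _ L'0 (dvdn_trans (dvdn_mull _ (dvdnn _)) LL).
  exists (B ++ C); first by move=> q; rewrite mem_cat => /orP[/B0|/C0].
  move=> v x; have [VV|[q qB hq]] := hB v x; last first.
    by right; exists q => //; rewrite mem_cat qB.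
  have [WW|[q qB hq]] := hC v x; last first.
    by right; exists q => //; rewrite mem_cat qB orbT.
  by left; rewrite VV WW.
- exists L => // L' L'0 /(hL _ L'0) [B B0 hB]; exists B => // v x.
  by rewrite -!VW.
Qed.

Lemma qf_upd j V : qf V -> qf (fun v => exists x, V (upd v j x)).
Proof.
move=> qV; have [L L0 /(_ L L0 (dvdnn L)) [B B0 hB]] := qf_break j qV.
have aupd f x : affine f -> affine (fun v => f (upd v j x)).
  move=> [p fE]; exists ([ffun k => if k == j then 0 else p.1 k], p.2 + p.1 j * x%:Z) => v.
  rewrite fE aeval_upd /aeval /= -addrA; congr (_ + _).
  rewrite /lcomb; apply: eq_bigr => k _; rewrite !ffunE; case: eqP => // _.
  by rewrite mulr0n mul0rn.
have qx x : qf (fun v => V (upd v j x)).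
  apply: (qf_comp qV) => k; rewrite /upd.
  case: (eqVneq k j) => kj.
    by have [p pE] := affine_cst K x%:Z; exists p => v; rewrite ffunE kj eqxx -pE.
  have [p pE] := affine_coord k; exists p => v; by rewrite ffunE (negbTE kj) pE.
have qB p : p \in B -> qf (fun v => exists2 x,
    p.1%:Z * x%:Z = aeval p.2 (upd v j 0) & V (upd v j x)).
  move=> pB; have a0 := B0 p pB.
  have at0 : affine (fun v => aeval p.2 (upd v j 0)) by apply: aupd; exists p.2.
  (* All coordinates are put over the denominator [p.1]; at [j] the numerator is the right-hand side
     of the breakpoint equation. *)
  pose F k v := if k == j then aeval p.2 (upd v j 0) else p.1%:Z * (v k)%:Z.
  have [k|W qW VW] := @qf_subst _ _ _ _ F qV a0.
    by apply: affine_if => //; apply: affineZ; apply: affine_coord.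
  (* The breakpoint equation has a solution in the natural numbers iff its right-hand side is
     nonnegative and divisible by [p.1]. *)
  apply: qf_ext (qf_and (qf_and (qf_ge0 at0) (qf_dvd a0 at0)) qW) => v.
  have FE x : p.1%:Z * x%:Z = aeval p.2 (upd v j 0) ->
      (forall k, p.1%:Z * (upd v j x k)%:Z = F k v).
    by move=> hx k; rewrite /F ffunE; case: eqP.
  split.
    move=> [[t0 /dvdzP [q tq]] Wv].
    have q0 : 0 <= q by rewrite tq pmulr_lge0 in t0.
    have hx : p.1%:Z * `|q|%N%:Z = aeval p.2 (upd v j 0).
      by rewrite gez0_abs // mulrC tq.
    by exists `|q|%N => //; apply/(VW v _ (FE _ hx)).
  move=> [x hx Vx]; split; last by apply/(VW v _ (FE _ hx)).
  by rewrite -hx; split; rewrite ?dvdz_mulr.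
apply: qf_ext (qf_or (qf_exists (fun x : 'I_L => qx x)) (qf_exists_in qB)) => v.
split; first by case=> [[x Vx]|[p _ [x _ Vx]]]; [exists x | exists x].
(* Descent: a witness that is neither below [L] nor a breakpoint can be replaced by [x - L]. *)
case=> x; elim/ltn_ind: x => x IH Vx.
have [xL|Lx] := ltnP x L; first by left; exists (Ordinal xL).
have [hx|[p pB]] := hB v (x - L)%N.
  apply: (IH (x - L)%N); first by lia.
  by apply/hx; rewrite subnK.
by rewrite subnK // => hp; right; exists p => //; exists x.
Qed.

Lemma qf_exists_off (s : seq K) V :
  qf V -> qf (fun v => exists2 u : vec K, (forall k, k \notin s -> u k = v k) & V u).
Proof.
move=> qV; elim: s => [|j s IH].
  apply: qf_ext qV => v; split=> [Vv|[u uv Vu]]; first by exists v.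
  by rewrite (_ : v = u) //; apply/ffunP => k; rewrite uv.
apply: qf_ext (qf_upd j IH) => v; split.
  case=> x [u uv Vu]; exists u => // k; rewrite inE negb_or => /andP[kj ks].
  by rewrite uv // ffunE (negbTE kj).
case=> u uv Vu; exists (u j), u => // k ks; rewrite ffunE; case: eqP => [->//|/eqP kj].
by apply: uv; rewrite inE negb_or kj.
Qed.

(** Projection onto the coordinates in the range of [e], the form in which set quantifiers and
    Presburger quantifiers are eliminated. *)
Lemma qf_exists_ext (I : finType) (e : I -> K) V : injective e -> qf V ->
  qf (fun w : vec I => exists2 u : vec K, (forall i, u (e i) = w i) & V u).
Proof.
move=> e_inj /(qf_exists_off [seq k <- enum K | k \notin codom e]) qV.
(* The default 0 off the range of [e] is arbitrary, since exactly those coordinates are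
   quantified. *)
pose F (w : vec I) : vec K :=
  [ffun k => if [pick i | e i == k] is Some i then w i else 0%N].
have Fe w i : F w (e i) = w i.
  by rewrite ffunE; case: pickP => [l /eqP/e_inj ->|/(_ i)]; rewrite ?eqxx.
have aF k : affine (fun w => (F w k)%:Z).
  case E : [pick i | e i == k] => [i|].
    by have [p pE] := affine_coord i; exists p => w; rewrite ffunE E pE.
  by have [p pE] := affine_cst I 0; exists p => w; rewrite ffunE E -pE.
apply: qf_ext (qf_comp qV aF) => w; split=> -[u uw Vu]; exists u => //.
  by move=> i; rewrite uw ?Fe // mem_filter codom_f.
move=> k; rewrite mem_filter mem_enum andbT negbK => /codomP [i ->].
by rewrite uw Fe.
Qed.

End Elimination.

(** * Formulas and type counts *)

Lemma card_tag (X : finType) (w : X -> nat) (P : pred X) :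
  #|[set y : {z : X & 'I_(w z)} | P (tag y)]| = \sum_(z | P z) w z.
Proof.
rewrite -sum1dep_card.
transitivity (\sum_(z | P z) \sum_(i < w z) 1); last first.
  by apply: eq_bigr => z _; rewrite sum1_card card_ord.
by rewrite sig_big_dep; apply: eq_bigl => y; rewrite andbT.
Qed.

(** * Splitting a finite set into parts of prescribed sizes *)

Section Fibres.
Variables (D T : finType) (f : D -> T).

Lemma card_fibres : #|D| = \sum_t #|[set d | f d == t]|.
Proof.
rewrite -sum1_card (partition_big f predT) //=.
by apply: eq_bigr => t _; rewrite sum1dep_card.
Qed.

(** Elements of the two fibres over the same [t] are matched by their position in the
    enumerations. *)
Lemma fibrewise_injection (Y : finType) (g : Y -> T) :
  (forall t, #|[set d | f d == t]| = #|[set y | g y == t]|) ->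
  exists2 h : D -> Y, injective h & forall d, g (h d) = f d.
Proof.
move=> fg; pose F t := enum [set d | f d == t]; pose G t := enum [set y | g y == t].
have FG t : size (F t) = size (G t) by rewrite -!cardE.
have dF d : d \in F (f d) by rewrite mem_enum inE.
(* [nth] needs a default in [Y]: an empty [D] needs no values at all, and otherwise the fibre over
   [f d0] supplies one. *)
have [d0 _|D0] := pickP (@predT D); last first.
  by exists (fun d => False_rect Y (Bool.diff_true_false (D0 d))) => d; have := D0 d.
have [y0 _] : exists2 y, y \in G (f d0) & true.
  have : 0 < size (G (f d0)).
    by rewrite -FG; apply: leq_ltn_trans (_ : index d0 (F (f d0)) < _); rewrite ?index_mem.
  by case: (G (f d0)) => // y s _; exists y; rewrite ?mem_head.
pose h d := nth y0 (G (f d)) (index d (F (f d))).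
have gh d : g (h d) = f d.
  have : h d \in G (f d) by rewrite mem_nth // -FG index_mem.
  by rewrite mem_enum inE => /eqP.
exists h => // d d' hd.
have ff : f d = f d' by rewrite -!gh hd.
move: hd; rewrite /h ff => /eqP; rewrite nth_uniq ?enum_uniq -?FG ?index_mem //.
  by rewrite -{1}ff => /eqP hi; have := nth_index d (dF d); rewrite hi ff nth_index.
by rewrite -ff.
Qed.

(** Any numerical splitting of the fibres of [f] is realised by a splitting of the elements: [D] is
    identified, over [T], with the disjoint sum of [w z] copies of each [z]. Sets are recovered from
    their cardinalities in this way. *)
Lemma labelling (X : finType) (own : X -> T) (w : X -> nat) :
  (forall t, #|[set d | f d == t]| = \sum_(z | own z == t) w z) ->
  exists2 h : D -> X, forall d, own (h d) = f d &
    forall z, #|[set d | h d == z]| = w z.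
Proof.
move=> fw; pose Y := {z : X & 'I_(w z)}.
have [|h h_inj hE] := @fibrewise_injection Y (fun y => own (tag y)).
  by move=> t; rewrite fw (card_tag _ (fun z => own z == t)).
have [h' hK h'K] : bijective h.
  apply: inj_card_bij => //; rewrite card_fibres.
  rewrite (eq_bigr _ (fun t _ => fw t)) -(@partition_big _ _ _ _ _ _ predT own predT) //=.
  by rewrite -(card_tag w predT) cardsE; apply/subset_leq_card/subsetP.
exists (fun d => tag (h d)) => // z.
have -> : w z = \sum_(y | y == z) w y by rewrite big_pred1_eq.
rewrite -(card_tag w (fun y => y == z)).
rewrite -(card_imset _ h_inj); apply: eq_card => y; rewrite !inE.
apply/imsetP/idP => [[d]|yz]; first by rewrite inE => hd ->.
by exists (h' y); rewrite ?inE h'K.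
Qed.

End Fibres.

Section EnvCons.
Variables (T : Type) (k : nat) (t : T) (e : {ffun 'I_k -> T}).

Lemma env_cons0 : env_cons t e ord0 = t.
Proof. by rewrite ffunE unlift_none. Qed.

Lemma env_consS i : env_cons t e (lift ord0 i) = e i.
Proof. by rewrite ffunE liftK. Qed.

End EnvCons.

(** * Satisfaction depends only on the counts of types *)

Section Types.
Variable Pred : finType.

(* The type of an element records the predicates that hold at it, the individual
   variables denoting it, and the set variables containing it. *)
Definition typ (k m : nat) : finType :=
  ({set Pred} * {set 'I_k} * {set 'I_m})%type.

Section TypeCounts.
Variables (M : finmodel Pred) (k m : nat).
Variables (e : {ffun 'I_k -> domain M}) (s : {ffun 'I_m -> {set domain M}}).

Definition tp (d : domain M) : typ k m :=
  ([set P | d \in interp M P], [set x | e x == d], [set X | d \in s X]).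

Definition counts : vec (typ k m) := [ffun t => #|[set d | tp d == t]|].

Lemma sum_counts (A : pred (typ k m)) :
  \sum_(t | A t) counts t = #|[set d | A (tp d)]|.
Proof.
rewrite -sum1dep_card (partition_big tp A) //=; apply: eq_bigr => t At.
rewrite ffunE -sum1dep_card; apply: eq_bigl => d.
by case: eqP => [->|]; rewrite ?At ?andbF.
Qed.

Lemma sum_counts_gt0 (A : pred (typ k m)) :
  0 < \sum_(t | A t) counts t <-> exists d, A (tp d).
Proof.
rewrite sum_counts; split=> [/card_gt0P [d]|[d Ad]].
  by rewrite inE; exists d.
by apply/card_gt0P; exists d; rewrite inE.
Qed.

End TypeCounts.

(** The Boolean keeps whether the removed variable 0 names the element, so no information is
    lost. *)
Definition drop_ivar k m (t : typ k.+1 m) : typ k m * bool :=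
  ((t.1.1, [set x | lift ord0 x \in t.1.2], t.2), ord0 \in t.1.2).

Definition drop_svar k m (t : typ k m.+1) : typ k m * bool :=
  ((t.1, [set X | lift ord0 X \in t.2]), ord0 \in t.2).

Lemma drop_ivar_inj k m : injective (@drop_ivar k m).
Proof.
move=> [[P K] X] [[P' K'] X'] [/= -> /setP KK' -> KK0]; congr (_, _, _).
apply/setP => i; case: (unliftP ord0 i) => [j ->|-> //].
by have := KK' j; rewrite !inE.
Qed.

Lemma drop_svar_inj k m : injective (@drop_svar k m).
Proof.
move=> [PK X] [PK' X'] [/= -> /setP XX' XX0]; congr (_, _).
apply/setP => i; case: (unliftP ord0 i) => [j ->|-> //].
by have := XX' j; rewrite !inE.
Qed.

Lemma drop_ivar_tp M k m e s d d0 :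
  drop_ivar (@tp M k.+1 m (env_cons d e) s d0) = (tp e s d0, d0 == d).
Proof.
rewrite /drop_ivar /tp /= inE env_cons0 eq_sym; congr (_, _, _, _).
by apply/setP => x; rewrite !inE env_consS.
Qed.

Lemma drop_svar_tp M k m e s A d :
  drop_svar (@tp M k m.+1 e (env_cons A s) d) = (tp e s d, d \in A).
Proof.
rewrite /drop_svar /tp /= inE env_cons0; congr (_, _, _).
by apply/setP => x; rewrite !inE env_consS.
Qed.

Definition typ_definable k m (f : form Pred k m) : Prop :=
  exists2 R, qf R & forall M e s, @sat Pred M k m f e s <-> R (counts e s).

Lemma qf_sum_gt0 (K : finType) (A : pred K) :
  qf (fun v : vec K => 0 < \sum_(k | A k) v k).
Proof.
have aS : affine (fun v : vec K => (\sum_(k | A k) (v k)%:Z - 1)%R).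
  apply: affineD (affine_cst _ _); apply: affine_sum => k; exact: affine_coord.
apply: qf_ext (qf_ge0 aS) => v /=.
by rewrite -(big_morph Posz PoszD (erefl _)); split; lia.
Qed.

Lemma qf_sum_le (K : finType) (A B : pred K) :
  qf (fun v : vec K => \sum_(k | A k) v k <= \sum_(k | B k) v k).
Proof.
have aS (C : pred K) : affine (fun v : vec K => (\sum_(k | C k) (v k)%:Z)%R).
  by apply: affine_sum => k; exact: affine_coord.
apply: qf_ext (qf_ge0 (affineD (aS B) (affineN (aS A)))) => v /=.
by rewrite -!(big_morph Posz PoszD (erefl _)); split; lia.
Qed.

(* The new variable lowers the number of unnamed elements of type [t] by one. *)
Lemma typ_definable_cons k m (g : form Pred k.+1 m) : typ_definable g ->
  exists2 Q : typ k m -> vec (typ k m) -> Prop, forall t, qf (Q t) &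
    forall M e s d, @sat Pred M _ _ g (env_cons d e) s <-> Q (tp e s d) (counts e s).
Proof.
move=> [R qR RE].
suff: forall t, exists Q, qf Q /\ forall M e s d, tp e s d = t ->
    (@sat Pred M k.+1 m g (env_cons d e) s <-> Q (counts e s)).
  move=> /fin_all_exists [Q hQ]; exists Q => [t|M e s d]; first by case: (hQ t).
  by apply: (proj2 (hQ _)).
move=> t.
(* The counts after an element of type [t] is named: the types containing the new variable occur
   once, for [u = t], or not at all, and [t] without it loses one element. *)
pose F (t' : typ k.+1 m) (c : vec (typ k m)) : int :=
  let: (u, b) := drop_ivar t' in
  (if b then (u == t : nat)%:Z else (c u)%:Z + - (u == t : nat)%:Z)%R.
have [|W qW WE] := @qf_subst _ _ R 1 F qR isT.
  move=> t'; rewrite /F; case: (drop_ivar t') => u b.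
  apply: affine_if; first exact: affine_cst.
  by apply: affineD (affine_cst _ _); apply: affine_coord.
exists W; split=> // M e s d td; rewrite RE; apply: WE => t'.
rewrite mul1r /F; case E : (drop_ivar t') => [u b].
have -> : counts (env_cons d e) s t' = #|[set d0 | (tp e s d0 == u) && ((d0 == d) == b)]|.
  rewrite ffunE; apply: eq_card => d0.
  by rewrite !inE -(inj_eq (@drop_ivar_inj _ _)) E drop_ivar_tp.
case: b {E}.
  congr Posz; case: eqP => [->|ut].
    transitivity #|[set d]|; last by rewrite cards1.
    apply: eq_card => d0; rewrite !inE.
    by case: (eqVneq d0 d) => [->|]; rewrite ?andbF // td !eqxx.
  apply: eq_card0 => d0; rewrite !inE.
  by case: (eqVneq d0 d) => [->|]; rewrite ?andbF // td; case: eqP => // tu; case: ut.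
rewrite ffunE (cardsD1 d [set d0 | tp e s d0 == u]) inE td [u == t]eq_sym.
rewrite PoszD addrAC subrr add0r; congr Posz; apply: eq_card => d0.
by rewrite !inE andbC eqbF_neg.
Qed.

Lemma set_of_prop (T : finType) (P : T -> Prop) :
  exists A : {set T}, forall t, t \in A <-> P t.
Proof.
have /fin_all_exists [b bP] : forall t, exists b : bool, b <-> P t.
  by move=> t; have [Pt|nPt] := classic (P t); [exists true | exists false].
by exists [set t | b t] => t; rewrite inE.
Qed.

Lemma form_typ_definable k m (f : form Pred k m) : typ_definable f.
Proof.
elim: f => {k m} [k m P x|k m X x|k m x y|k m|k m g [R qR RE]
  |k m g [R qR RE] h [R' qR' RE']|k m g /typ_definable_cons [Q qQ QE]
  |k m g [R qR RE]|k m g /typ_definable_cons [Q qQ QE] h /typ_definable_cons [Q' qQ' QE']].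
- eexists; first exact: (qf_sum_gt0 (fun t : typ k m => (P \in t.1.1) && (x \in t.1.2))).
  move=> M e s /=; rewrite sum_counts_gt0; split=> [xP|[d]].
    by exists (e x); rewrite !inE eqxx xP.
  by rewrite !inE => /andP[dP /eqP ->].
- eexists; first exact: (qf_sum_gt0 (fun t : typ k m => (X \in t.2) && (x \in t.1.2))).
  move=> M e s /=; rewrite sum_counts_gt0; split=> [xP|[d]].
    by exists (e x); rewrite !inE eqxx xP.
  by rewrite !inE => /andP[dP /eqP ->].
- eexists; first exact: (qf_sum_gt0 (fun t : typ k m => (x \in t.1.2) && (y \in t.1.2))).
  move=> M e s /=; rewrite sum_counts_gt0; split=> [/eqP xy|[d]].
    by exists (e x); rewrite !inE xy eqxx.
  by rewrite !inE => /andP[/eqP -> /eqP ->].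
- by eexists; first exact: qf_true.
- eexists; first exact: (qf_not qR).
  by move=> M e s /=; rewrite -RE; split=> /negP.
- eexists; first exact: (qf_and qR qR').
  by move=> M e s /=; rewrite -RE -RE'; split=> /andP.
(* An element quantifier becomes a finite disjunction over the inhabited types. *)
- eexists; first exact: (qf_exists (fun t => qf_and (qf_sum_gt0 (pred1 t)) (qQ t))).
  move=> M e s; split=> /= [/existsP [d /QE hd]|[t [/sum_counts_gt0 [d /eqP <-]] /QE hd]].
    by exists (tp e s d); split=> //; apply/sum_counts_gt0; exists d; rewrite /= eqxx.
  by apply/existsP; exists d.
(* The [inl] coordinates count the old types and the [inr] coordinates the types refined by the new
   set. Each old count must be the sum of its refinements, and the refined counts are projected
   away. *)
- pose V (u : vec (typ k m + typ k m.+1)%type) :=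
    (forall t, u (inl t) = \sum_(t' | (drop_svar t').1 == t) u (inr t')) /\
    R [ffun t' => u (inr t')].
  have qV : qf V.
    apply: qf_and.
      apply: qf_forall => t.
      have aS : affine (fun u : vec (typ k m + typ k m.+1)%type =>
          (\sum_(t' | (drop_svar t').1 == t) (u (inr t'))%:Z)%R).
        by apply: affine_sum => t'; exact: affine_coord.
      apply: qf_ext (qf_eq (affine_coord (inl t)) aS) => u.
      by rewrite -(big_morph Posz PoszD (erefl _)); split=> [[]|->].
    apply: (qf_comp qR) => t'.
    have [p pE] := affine_coord (inr t' : (typ k m + typ k m.+1)%type).
    by exists p => v; rewrite ffunE.
  eexists; first exact: (qf_exists_ext (@inl_inj _ _) qV).
  move=> M e s /=; split.
    move=> /existsP [A /RE hA].
    pose u := [ffun x => match x with inl t => counts e s t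
                         | inr t' => counts e (env_cons A s) t' end]
      : vec (typ k m + typ k m.+1)%type.
    exists u; first by move=> t; rewrite ffunE.
    split=> [t|].
      rewrite ffunE (eq_bigr (counts e (env_cons A s))); last by move=> t' _; rewrite ffunE.
      rewrite (sum_counts _ _ (fun t' => (drop_svar t').1 == t)) ffunE.
      by apply: eq_card => d; rewrite !inE drop_svar_tp.
    rewrite (_ : [ffun _ => _] = counts e (env_cons A s)) //.
    by apply/ffunP => t'; rewrite !ffunE.
  case=> u uc [us Ru].
  (* Conversely, the refined counts are realised by labelling each element with a refinement of its
     type; the set is then read off the labels. *)
  have [|h hown hcard] := @labelling _ _ (tp e s) _ (fun t' : typ k m.+1 => (drop_svar t').1)
    (fun t' => u (inr t')).
    by move=> t; rewrite -us uc ffunE.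
  apply/existsP; exists [set d | ord0 \in (h d).2]; apply/RE.
  rewrite (_ : counts _ _ = [ffun t' => u (inr t')]) //.
  apply/ffunP => t'; rewrite !ffunE -hcard; apply: eq_card => d; rewrite !inE.
  rewrite -(_ : h d = tp _ _ d) //; apply: (@drop_svar_inj _ _).
  by rewrite drop_svar_tp -hown inE.
(* [A] and [B] are the sets of types whose elements satisfy [g] and [h]; once they are fixed, both
   cardinalities are sums of counts. *)
- eexists; first exact: (qf_exists (fun A : {set typ k m} => qf_exists (fun B : {set typ k m} =>
    qf_and (qf_and (qf_forall (fun t => qf_iff (qf_prop _ (t \in A)) (qQ t)))
       (qf_forall (fun t => qf_iff (qf_prop _ (t \in B)) (qQ' t))))
     (qf_sum_le (mem B) (mem A))))).
  move=> M e s /=.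
  have cardE (f : form Pred k.+1 m) (P : typ k m -> Prop) (A : {set typ k m}) :
      (forall d, sat f (env_cons d e) s <-> P (tp e s d)) -> (forall t, t \in A <-> P t) ->
      #|[set d | sat f (env_cons d e) s]| = \sum_(t in A) counts e s t.
    move=> fP AP; rewrite sum_counts; apply: eq_card => d; rewrite !inE.
    by apply/idP/idP => [/fP/AP|/AP/fP].
  split=> [hgh|[A [B [[hA hB]]]]].
    have [A hA] := set_of_prop (fun t => Q t (counts e s)).
    have [B hB] := set_of_prop (fun t => Q' t (counts e s)).
    exists A, B; split=> //.
    by rewrite -(cardE g _ A _ hA) // -(cardE h _ B _ hB).
  by rewrite -(cardE g _ A _ hA) // -(cardE h _ B _ hB).
Qed.

End Types.

(** * From definable sets to quantifier-free sets *)

Section StateDescriptions.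
Variable Pred : finType.

Lemma sat_bigand (M : finmodel Pred) k m (I : finType) (P : pred I)
    (F : I -> form Pred k m) e s :
  @sat Pred M k m (\big[FAnd/FTop]_(i | P i) F i) e s =
  [forall (i | P i), sat (F i) e s].
Proof.
by rewrite (big_morph (fun f => @sat Pred M k m f e s) (fun _ _ => erefl) erefl) big_andE.
Qed.

(** The state-description in a context of [m] set variables, as it occurs under set quantifiers. *)
Definition state_desc m (J : {set Pred}) : form Pred 1 m :=
  FAnd (\big[FAnd/FTop]_(P in J) FPred P ord0)
       (\big[FAnd/FTop]_(P | P \notin J) FNeg (FPred P ord0)).

Definition holds_at (M : finmodel Pred) (d : domain M) : {set Pred} :=
  [set P | d \in interp M P].

Lemma sat_state_desc (M : finmodel Pred) m (J : {set Pred}) d e s :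
  @sat Pred M 1 m (state_desc m J) (env_cons d e) s = (J == holds_at d).
Proof.
rewrite /= !sat_bigand; apply/andP/eqP => [[/forall_inP h1 /forall_inP h2]|->].
  apply/setP => P; rewrite inE; apply/idP/idP => [/h1|]; first by rewrite /= env_cons0.
  by apply: contraLR => /h2; rewrite /= env_cons0.
by split; apply/forall_inP => P; rewrite /= env_cons0 inE.
Qed.

Lemma card_ext_state_description (M : finmodel Pred) J :
  card_ext M (state_description J) = #|[set d : domain M | J == holds_at d]|.
Proof. by apply: eq_card => d; rewrite !inE (@sat_state_desc M 0). Qed.

(** A nonzero [v] is tested in the model with exactly [v i] elements of state [S i] and no others.
    Injectivity of [S] gives the extensions the sizes [v i], and the type counts [c v] are linear in
    [v]. *)
Lemma qf_MSO_definable n (S : 'I_n -> {set Pred}) (V : vec 'I_n -> Prop) :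
  injective S -> MSO_definable S V -> qf V.
Proof.
move=> S_inj [f fV]; have [R qR RE] := form_typ_definable f.
pose c (v : vec 'I_n) : vec (typ Pred 0 0) := [ffun t => \sum_(i | S i == t.1.1) v i].
have qc : qf (fun v => R (c v)).
  apply: (qf_comp qR) => t.
  have [|p pE] := @affine_sum 'I_n _ (index_enum _) (fun i => S i == t.1.1) (fun i v => (v i)%:Z)%R.
    by move=> i; apply: affine_coord.
  by exists p => v; rewrite ffunE -pE (big_morph Posz PoszD (erefl _)).
(* Domains are nonempty, so the test model does not exist for the zero vector, which is treated
   apart by a constant truth value. *)
apply: qf_ext (qf_or (qf_and (qf_sum_gt0 predT) qc)
  (qf_and (qf_not (qf_sum_gt0 predT)) (qf_prop _ (V [ffun=> 0])))) => v.
have [v0|v0] := posnP (\sum_(k | predT k) v k).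
  have -> : v = [ffun=> 0].
    apply/ffunP => i; rewrite ffunE; apply/eqP.
    by move/eqP: v0; rewrite sum_nat_eq0 => /forall_inP/(_ i isT).
  by split=> [[[]|[]]|] //; right.
pose D : finType := {i : 'I_n & 'I_(v i)}.
have D0 : 0 < #|D| by rewrite -cardsT (card_tag v predT).
pose M := @FinModel Pred D D0 (fun P => [set d : D | P \in S (tag d)]).
have MS (d : domain M) : holds_at d = S (tag d) by apply/setP => P; rewrite !inE.
have MV : [ffun i => card_ext M (state_description (S i))] = v.
  apply/ffunP => i; rewrite ffunE card_ext_state_description.
  rewrite -[RHS](big_pred1_eq addn i) -(card_tag v (pred1 i)).
  by apply: eq_card => d; rewrite !inE MS (inj_eq S_inj) eq_sym.
have MC : counts (env_nil (domain M)) (env_nil {set domain M}) = c v.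
  apply/ffunP => t; rewrite !ffunE -(card_tag v (fun i => S i == t.1.1)).
  apply: eq_card => d; rewrite !inE; apply/eqP/eqP => [<-|] /=.
    by rewrite -MS.
  rewrite -MS; case: t => [[P K] X] /= <-; congr (_, _, _).
    by apply/setP => -[].
  by apply/setP => -[].
have := fV M; rewrite /models MV => <-.
have -> : sat f (env_nil (domain M)) (env_nil {set domain M}) <-> R (c v).
  by rewrite RE MC.
by split=> [[[]|[]]|] //; left.
Qed.

End StateDescriptions.

(** * Sentences for semilinear sets *)

Section BlockSentence.
Variable Pred : finType.

Fixpoint ex_sets k m : form Pred k m -> form Pred k 0 :=
  match m with
  | 0 => id
  | m'.+1 => fun f => ex_sets (FEx2 f)
  end.

Lemma sat_ex_sets (M : finmodel Pred) k m (f : form Pred k m) e s0 :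
  @sat Pred M k 0 (ex_sets f) e s0 <-> exists s, @sat Pred M k m f e s.
Proof.
elim: m f => [|m IH] f /=.
  split=> [fs|[s]]; first by exists s0.
  by rewrite (_ : s = s0) //; apply/ffunP => -[].
rewrite IH; split=> [[s /existsP [A fA]]|[s fs]]; first by exists (env_cons A s).
exists [ffun i => s (lift ord0 i)]; apply/existsP; exists (s ord0).
rewrite (_ : env_cons _ _ = s) //; apply/ffunP => i.
by case: (unliftP ord0 i) => [j ->|->]; rewrite ?env_cons0 // env_consS ffunE.
Qed.

Definition FAll1 k m (f : form Pred k.+1 m) : form Pred k m := FNeg (FEx1 (FNeg f)).
Definition FImp k m (f g : form Pred k m) : form Pred k m := FNeg (FAnd f (FNeg g)).

Lemma sat_FAll1 (M : finmodel Pred) k m (f : form Pred k.+1 m) e s :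
  @sat Pred M k m (FAll1 f) e s <-> forall d, sat f (env_cons d e) s.
Proof.
rewrite /=; split=> [/existsPn h d|h]; first by have := h d; rewrite negbK.
by apply/existsPn => d; rewrite negbK.
Qed.

Lemma sat_FImp (M : finmodel Pred) k m (f g : form Pred k m) e s :
  @sat Pred M k m (FImp f g) e s = (sat f e s ==> sat g e s).
Proof. by rewrite /= negb_and negbK implybE. Qed.

Lemma sat_FAnd (M : finmodel Pred) k m (f g : form Pred k m) e s :
  @sat Pred M k m (FAnd f g) e s = sat f e s && sat g e s.
Proof. by []. Qed.

Lemma sat_FNeg (M : finmodel Pred) k m (f : form Pred k m) e s :
  @sat Pred M k m (FNeg f) e s = ~~ sat f e s.
Proof. by []. Qed.

Variables (n m : nat) (S : 'I_n -> {set Pred}).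
Variables (X : finType) (own : X -> 'I_n) (col : X -> 'I_m.+1).

(* Set variable number [enum_rank z] denotes the block [z] of the extension of
   [S (own z)]; the blocks of a column [j] are equinumerous, and those of column
   0 are singletons. *)
Definition block (z : X) k : form Pred k.+1 #|X| := FMem (enum_rank z) ord0.

(** The formula [y = x] has exactly one solution in [y], so the comparison bounds the block by one,
    and [x] itself is in it. *)
Definition singleton_block (z : X) : form Pred 0 #|X| :=
  FEx1 (FAnd (block z 0) (FCount (FEq ord0 (lift ord0 ord0)) (block z 1))).

(** The conjuncts are, in order, the clauses of [block_partition]. In the last one each pair of
    blocks is compared in both orders, which gives equality of the sizes. *)
Definition block_sentence : sentence Pred :=
  ex_sets (FAnd (FAnd
    (\big[FAnd/FTop]_z FAll1 (FImp (block z 0) (state_desc _ (S (own z)))))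
    (FAll1 (\big[FAnd/FTop]_i FImp (state_desc _ (S i))
      (FNeg (\big[FAnd/FTop]_(z | own z == i) FNeg (block z 0))))))
    (FAnd (FAnd
    (FAll1 (\big[FAnd/FTop]_(zz : X * X | zz.1 != zz.2)
      FNeg (FAnd (block zz.1 0) (block zz.2 0))))
    (\big[FAnd/FTop]_(z | col z == ord0) singleton_block z))
    (\big[FAnd/FTop]_(zz : X * X | col zz.1 == col zz.2)
      FCount (block zz.1 0) (block zz.2 0)))).

Definition block_partition (M : finmodel Pred) (B : X -> {set domain M}) : Prop :=
  [/\ forall z d, d \in B z -> S (own z) = holds_at d,
      forall i d, S i = holds_at d -> exists2 z, own z = i & d \in B z,
      forall z z' d, d \in B z -> d \in B z' -> z = z',
      forall z, col z = ord0 -> #|B z| = 1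
    & forall z z', col z = col z' -> #|B z| = #|B z'| ].

Lemma models_block_sentence (M : finmodel Pred) :
  models M block_sentence <-> exists B, @block_partition M B.
Proof.
rewrite /models sat_ex_sets.
have blockE z k d e s :
    @sat Pred M k.+1 #|X| (block z k) (env_cons d e) s = (d \in s (enum_rank z)).
  by rewrite /= env_cons0.
have singleE z e s : @sat Pred M 0 #|X| (singleton_block z) e s = (#|s (enum_rank z)| == 1).
  have c1 d : #|[set y | sat (FEq ord0 (lift ord0 ord0)) (env_cons y (env_cons d e)) s]| = 1.
    by apply/eqP/cards1P; exists d; apply/setP => y; rewrite !inE /= env_cons0 env_consS env_cons0.
  have c2 d : #|[set y | sat (block z 1) (env_cons y (env_cons d e)) s]| = #|s (enum_rank z)|.
    by apply: eq_card => y; rewrite inE blockE.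
  rewrite [sat _ _ _]/= eqn_leq; apply/existsP/andP => [[d]|[h1 /card_gt0P [d ds]]].
    by rewrite -/(block z 1) env_cons0 c1 c2 => /andP[ds h]; split=> //; apply/card_gt0P; exists d.
  by exists d; rewrite -/(block z 1) env_cons0 c1 c2 ds.
have countE z z' e s : @sat Pred M 0 #|X| (FCount (block z 0) (block z' 0)) e s =
    (#|s (enum_rank z')| <= #|s (enum_rank z)|).
  by rewrite [sat _ _ _]/=; congr leq; apply: eq_card => d; rewrite inE env_cons0.
split.
  case=> s; rewrite !sat_FAnd => /andP[/andP[]].
  rewrite sat_bigand => /forall_inP h1 /sat_FAll1 h2 /andP[/andP[/sat_FAll1 h3]].
  rewrite !sat_bigand => /forall_inP h4 /forall_inP h5.
  exists (fun z => s (enum_rank z)); split.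
  - move=> z d dz; have /sat_FAll1/(_ d) := h1 z isT.
    by rewrite sat_FImp blockE dz sat_state_desc => /eqP.
  - move=> i d Sd; have := h2 d; rewrite sat_bigand => /forall_inP/(_ i isT).
    rewrite sat_FImp sat_state_desc Sd eqxx /= sat_bigand => /forall_inPn [z /eqP zi].
    by rewrite /= env_cons0 negbK; exists z.
  - move=> z z' d dz dz'; have := h3 d; rewrite sat_bigand => /forall_inP/(_ (z, z')).
    by rewrite /= !env_cons0 dz dz'; case: eqP => // _ /(_ isT).
  - by move=> z /eqP/h4; rewrite singleE => /eqP.
  - move=> z z' zz; apply/eqP; rewrite eqn_leq.
    have := h5 (z, z'); have := h5 (z', z); rewrite !countE /= zz eqxx.
    by move=> -> // ->.
case=> B [h1 h2 h3 h4 h5]; pose s : {ffun 'I_#|X| -> {set domain M}} := [ffun x => B (enum_val x)].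
have sB z : s (enum_rank z) = B z by rewrite ffunE enum_rankK.
exists s; rewrite !sat_FAnd; apply/andP; split; apply/andP; split; rewrite ?sat_bigand.
- apply/forall_inP => z _; apply/sat_FAll1 => d; rewrite sat_FImp blockE sat_state_desc sB.
  by apply/implyP => /h1 ->.
- apply/sat_FAll1 => d; rewrite sat_bigand; apply/forall_inP => i _.
  rewrite sat_FImp sat_state_desc sat_FNeg sat_bigand.
  apply/implyP => /eqP/h2 [z zi dz]; apply/forall_inPn.
  by exists z; [rewrite unfold_in zi; exact: (eqxx i) | rewrite sat_FNeg blockE negbK sB].
- apply/andP; split.
    apply/sat_FAll1 => d; rewrite sat_bigand; apply/forall_inP => -[z z'] /= zz.
    by rewrite !env_cons0 !sB; apply: contraNN zz => /andP[dz /(h3 _ _ _ dz) ->].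
  by apply/forall_inP => z /eqP/h4; rewrite singleE sB => ->.
- by apply/forall_inP => zz /eqP/h5 zzE; rewrite countE !sB zzE.
Qed.

(** Column 0 carries the constant term, the later columns the multipliers [u j]. *)
Definition column_size (u : vec 'I_m) (j : 'I_m.+1) : nat := oapp u 1 (unlift ord0 j).

Lemma block_partitionP (M : finmodel Pred) : injective S ->
  (exists B, @block_partition M B) <->
  exists u, forall i, #|[set d : domain M | S i == holds_at d]| =
    \sum_(z | own z == i) column_size u (col z).
Proof.
move=> S_inj; split.
  case=> B [h1 h2 h3 h4 h5].
  (* Any block of a column gives its size; for a column without blocks the value 0 is arbitrary. *)
  exists [ffun j => if [pick z | col z == lift ord0 j] is Some z then #|B z| else 0] => i.
  have -> : [set d | S i == holds_at d] = \bigcup_(z | own z == i) B z.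
    apply/setP => d; rewrite inE; apply/eqP/bigcupP => [/h2 [z zi dz]|[z /eqP <- /h1 //]].
    by exists z; rewrite ?zi.
  rewrite big_mkcond [RHS]big_mkcond -sum1_card partition_disjoint_bigcup /=.
    apply: eq_bigr => z _; case: eqP => _; last by rewrite big_set0.
    rewrite sum1_card /column_size; case: unliftP => [j|] zj; last by rewrite h4.
    rewrite /= ffunE; case: pickP => [z' /eqP zj'|/(_ z)]; rewrite ?zj ?eqxx //.
    by apply: h5; rewrite zj.
  move=> z z' zz; case: eqP => _; last by rewrite disjoints_subset sub0set.
  case: eqP => _; last by rewrite disjoint_sym disjoints_subset sub0set.
  apply/pred0P => d /=; apply/negP => /andP[dz /(h3 _ _ _ dz) zE].
  by rewrite zE eqxx in zz.
case=> u hu.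
pose f (d : domain M) : option 'I_n := [pick i | S i == holds_at d].
have fP d i : (f d == Some i) = (S i == holds_at d).
  rewrite /f; case: pickP => [l /eqP <-|/(_ i) -> //].
  by rewrite (inj_eq S_inj); apply/eqP/eqP => [[]|->].
(* The extra label collects the elements whose state is none of the [S i], so that the fibre over
   [None] is accounted for as well. *)
pose ow (x : X + unit) := if x is inl z then Some (own z) else None.
pose w (x : X + unit) := if x is inl z then column_size u (col z) else #|[set d | f d == None]|.
have [|h hf hw] := @labelling _ _ f _ ow w.
  move=> t; rewrite big_sumType /=; case: t => [i|].
    rewrite [X in _ + X]big_pred0 // addn0; transitivity #|[set d : domain M | S i == holds_at d]|.
      by apply: eq_card => d; rewrite !inE fP.
    by rewrite hu.
  by rewrite big_pred0 // add0n (big_pred1 tt) // => -[].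
exists (fun z => [set d | h d == inl z]); split.
- move=> z d; rewrite inE => /eqP hd; apply/eqP.
  by rewrite -fP -hf hd.
- move=> i d /eqP; rewrite -fP -hf; case E : (h d) => [z|] //= /eqP [zi].
  by exists z; rewrite // inE E.
- by move=> z z' d; rewrite !inE => /eqP -> /eqP [].
- by move=> z z0; rewrite hw /= z0 /column_size unlift_none.
- by move=> z z' zz; rewrite !hw /= zz.
Qed.

End BlockSentence.

(** * Linear and semilinear sets are definable *)

Section SemilinearDefinable.
Variables (Pred : finType) (n : nat) (S : 'I_n -> {set Pred}).
Hypothesis S_inj : injective S.

Lemma linear_MSO_definable (V : vec 'I_n -> Prop) : linear_set V -> MSO_definable S V.
Proof.
move=> [m [b [a VE]]].
(* The number of blocks in row [i] is [b i] for column 0 and [a i j] for the column of [u j]; [X]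
   has one element per block. *)
pose coef (ij : 'I_n * 'I_m.+1) : nat := oapp (a ij.1) (b ij.1) (unlift ord0 ij.2).
pose X : finType := {ij & 'I_(coef ij)}.
exists (@block_sentence Pred n m S X (fun z => (tag z).1) (fun z => (tag z).2)) => M.
rewrite models_block_sentence block_partitionP // VE.
have sumE u i : \sum_(z : X | (tag z).1 == i) column_size u (tag z).2 =
    b i + \sum_(j < m) a i j * u j.
  transitivity (\sum_(ij | ij.1 == i) \sum_(l < coef ij) column_size u ij.2).
    by rewrite sig_big_dep; apply: eq_bigl => z; rewrite andbT.
  rewrite (reindex_onto (pair i) snd) /=; last by move=> [i' j] /= /eqP ->.
  rewrite big_mkcond big_ord_recl /= !eqxx sum_nat_const card_ord.
  rewrite /coef /column_size /= unlift_none /= muln1; congr (_ + _).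
  apply: eq_bigr => j _.
  by rewrite !eqxx /= sum_nat_const card_ord liftK.
split=> -[u hu]; exists u.
  by apply/ffunP => i; rewrite !ffunE card_ext_state_description hu sumE.
move=> i; move/ffunP/(_ i): hu.
by rewrite !ffunE card_ext_state_description sumE.
Qed.

Lemma semilinear_MSO_definable (V : vec 'I_n -> Prop) :
  semilinear_set V -> MSO_definable S V.
Proof.
move=> [r [L [linL VE]]].
have /fin_all_exists [f fE] := fun l => linear_MSO_definable (linL l).
exists (FNeg (\big[FAnd/FTop]_l FNeg (f l))) => M.
rewrite VE /models sat_FNeg sat_bigand; split.
  move=> /forall_inPn [l _]; rewrite sat_FNeg negbK => /fE; by exists l.
case=> l /fE Ml; apply/forall_inPn; exists l => //.
by rewrite sat_FNeg negbK.
Qed.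

End SemilinearDefinable.

(** * Presburger arithmetic *)

Section Presburger.

Lemma affine_peval k (t : pterm k) : affine (fun e => Posz (peval e t)).
Proof.
elim: t => [x|t1 a1 t2 a2] /=; first exact: affine_coord.
by have [p pE] := affineD a1 a2; exists p => e; rewrite PoszD pE.
Qed.

Lemma qf_psat k (f : pform k) : qf (psat f).
Proof.
elim: f => {k} [k t1 t2|k g qg|k g qg h qh|k g qg] /=.
- apply: qf_ext (qf_eq (affine_peval t1) (affine_peval t2)) => e.
  by split=> [[]|->].
- exact: qf_not.
- exact: qf_and.
- apply: qf_ext (qf_exists_ext (@lift_inj _ ord0) qg) => e; split.
    case=> u ue gu; exists (u ord0).
    rewrite (_ : env_cons _ _ = u) //; apply/ffunP => i.
    by case: (unliftP ord0 i) => [j ->|->]; rewrite ?env_cons0 // env_consS ue.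
  by case=> d gd; exists (env_cons d e) => // i; rewrite env_consS.
Qed.

Fixpoint pexs N k : pform (N + k) -> pform k :=
  match N with
  | 0 => id
  | N'.+1 => fun f => pexs (PEx f)
  end.

Definition env_cat N k (u : vec 'I_N) (e : vec 'I_k) : vec 'I_(N + k) :=
  [ffun i => match split i with inl x => u x | inr y => e y end].

Lemma env_cat_lshift N k (u : vec 'I_N) (e : vec 'I_k) i :
  env_cat u e (lshift k i) = u i.
Proof. by rewrite ffunE (unsplitK (inl i)). Qed.

Lemma env_cat_rshift N k (u : vec 'I_N) (e : vec 'I_k) i :
  env_cat u e (rshift N i) = e i.
Proof. by rewrite ffunE (unsplitK (inr i)). Qed.

Lemma psat_pexs N k (f : pform (N + k)) e :
  psat (pexs f) e <-> exists u, psat f (env_cat u e).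
Proof.
elim: N f => [|N IH] f.
  have catE u : env_cat u e = e :> vec 'I_(0 + k).
    apply/ffunP => i; rewrite -[i in LHS](_ : rshift 0 i = i) ?env_cat_rshift //.
    exact/val_inj.
  split=> [fe|[u]]; last by rewrite catE.
  by exists [ffun=> 0]; rewrite catE.
rewrite /= IH /=.
have consE d u : env_cons d (env_cat u e) = env_cat (env_cons d u) e :> vec 'I_(N.+1 + k).
  apply/ffunP => i; rewrite -[i]splitK; case: (split i) => j; rewrite /unsplit.
    rewrite env_cat_lshift; case: (unliftP ord0 j) => [l ->|->].
      rewrite env_consS (_ : lshift k (lift ord0 l) = lift ord0 (lshift k l)); last exact/val_inj.
      by rewrite env_consS env_cat_lshift.
    by rewrite env_cons0 (_ : lshift k ord0 = ord0) ?env_cons0 //; apply/val_inj.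
  rewrite env_cat_rshift (_ : rshift N.+1 j = lift ord0 (rshift N j)); last exact/val_inj.
  by rewrite env_consS env_cat_rshift.
split=> [[u [d]]|[u]]; first by rewrite consE => ?; exists (env_cons d u).
move=> fu; exists [ffun i => u (lift ord0 i)], (u ord0).
rewrite consE (_ : env_cons _ _ = u) //; apply/ffunP => i.
by case: (unliftP ord0 i) => [j ->|->]; rewrite ?env_cons0 // env_consS ffunE.
Qed.

(** The equation [x + x = x] singles out 0 without a constant. *)
Definition is_zero k (x : 'I_k) : pform k := PEq (PAdd (PVar x) (PVar x)) (PVar x).

(* 1 is the only nonzero number that is not a sum of two nonzero numbers. *)
Definition is_one k (x : 'I_k) : pform k :=
  PAnd (PNeg (is_zero x)) (PNeg (PEx (PEx
    (PAnd (PEq (PAdd (PVar ord0) (PVar (lift ord0 ord0)))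
               (PVar (lift ord0 (lift ord0 x))))
       (PAnd (PNeg (is_zero ord0)) (PNeg (is_zero (lift ord0 ord0)))))))).

Lemma psat_is_one k (x : 'I_k) e : psat (is_one x) e <-> e x = 1.
Proof.
rewrite /=; split=> [[x0 x1]|x1].
  apply: NNPP => nx; apply: x1; exists (e x - 1), 1.
  by rewrite !(env_consS, env_cons0); lia.
split; first by lia.
by case=> y [z]; rewrite !(env_consS, env_cons0); lia.
Qed.

Definition padd_mul k (c : nat) (x : 'I_k) (t : pterm k) : pterm k :=
  iter c (PAdd (PVar x)) t.

Lemma peval_padd_mul k c x (t : pterm k) e :
  peval e (padd_mul c x t) = c * e x + peval e t.
Proof. by elim: c => //= c ->; rewrite mulSn addnA. Qed.

Lemma peval_foldr k (I : Type) (s : seq I) (c : I -> nat) (x : I -> 'I_k) t e :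
  peval e (foldr (fun i => padd_mul (c i) (x i)) t s) =
  \sum_(i <- s) c i * e (x i) + peval e t.
Proof.
elim: s => [|i s IH] /=; first by rewrite big_nil.
by rewrite peval_padd_mul IH big_cons addnA.
Qed.

Lemma psat_foldr_and k (I : eqType) (s : seq I) (F : I -> pform k) p e :
  psat (foldr (fun i => PAnd (F i)) p s) e <->
  (forall i, i \in s -> psat (F i) e) /\ psat p e.
Proof.
elim: s => [|i s IH] /=; first by split=> [|[]].
rewrite IH; split=> [[Fi [Fs pe]]|[Fs pe]].
  by split=> // l; rewrite inE => /predU1P[->|/Fs].
split; first by apply: Fs; rewrite mem_head.
by split=> // l ls; apply: Fs; rewrite inE ls orbT.
Qed.

(* The language has no constants, hence the witness for 1; it is added to both
   sides of the equations since there is no term denoting 0 either. *)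
Lemma Presburger_definable_linear n m (b : vec 'I_n) (a : 'I_m -> vec 'I_n) :
  Presburger_definable (fun v => exists u, v = (b + lcomb a u)%R).
Proof.
(* Variable 0 is the witness for 1, the next [m] are the multipliers, and the last [n] are the
   coordinates of [v]. *)
pose one : 'I_(m.+1 + n) := lshift n ord0.
pose x (j : 'I_m) : 'I_(m.+1 + n) := lshift n (lift ord0 j).
pose eqn (i : 'I_n) : pform (m.+1 + n) :=
  PEq (PAdd (PVar (rshift m.+1 i)) (PVar one))
      (padd_mul (b i) one (foldr (fun j => padd_mul (a j i) (x j)) (PVar one) (enum 'I_m))).
exists (pexs (foldr (fun i => PAnd (eqn i)) (is_one one) (enum 'I_n))) => v.
rewrite psat_pexs.
have catE u : psat (foldr (fun i => PAnd (eqn i)) (is_one one) (enum 'I_n)) (env_cat u v) <->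
    u ord0 = 1 /\ v = (b + lcomb a [ffun j => u (lift ord0 j)])%R.
  rewrite psat_foldr_and psat_is_one env_cat_lshift.
  have eqnE i : u ord0 = 1 -> psat (eqn i) (env_cat u v) <->
      v i = b i + \sum_(j < m) a j i * u (lift ord0 j).
    move=> u1; rewrite /= peval_padd_mul peval_foldr /=.
    rewrite env_cat_rshift !env_cat_lshift u1 muln1 addnA.
    rewrite big_enum /=.
    under eq_bigr do rewrite env_cat_lshift.
    by split=> [/addIn|->].
  split=> [[h u1]|[u1 vE]]; split=> //.
    apply/ffunP => i; have := h i; rewrite mem_enum => /(_ isT)/(eqnE i u1) ->.
    by rewrite lcombE ffunE; congr addn; apply: eq_bigr => j _; rewrite ffunE.
  move=> i _; apply/(eqnE i u1).
  rewrite vE lcombE ffunE; congr addn.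
  by apply: eq_bigr => j _; rewrite ffunE.
split=> [[u vE]|[u /(iffLR (catE u)) [_ vE]]]; last by exists [ffun j => u (lift ord0 j)].
exists (env_cons 1 u); apply: (iffRL (catE _)); rewrite env_cons0 {1}vE; split=> //.
by congr (_ + lcomb _ _)%R; apply/ffunP => j; rewrite ffunE env_consS.
Qed.

Lemma slin_Presburger n (V : vec 'I_n -> Prop) : slin V -> Presburger_definable V.
Proof.
elim=> {V} [m b a||V W _ [f fE] _ [g gE]|V W VW _ [f fE]].
- exact: Presburger_definable_linear.
- exists (PEx (PNeg (PEq (PVar ord0) (PVar ord0)))) => v /=.
  by split=> // -[].
- exists (PNeg (PAnd (PNeg f) (PNeg g))) => v /=; rewrite fE gE; tauto.
- by exists f => v; rewrite -VW.
Qed.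

End Presburger.

Theorem theorem4p8 (Pred : finType) (n : nat) (S : 'I_n -> {set Pred})
    (S_inj : injective S) (V : {ffun 'I_n -> nat} -> Prop) :
  (MSO_definable S V <-> semilinear_set V) /\
  (MSO_definable S V <-> Presburger_definable V).
Proof.
have MSO_slin : MSO_definable S V -> slin V.
  by move=> /(qf_MSO_definable S_inj)/slin_qf.
split; split.
- by move=> /MSO_slin/semilinear_slin.
- exact: semilinear_MSO_definable.
- by move=> /MSO_slin/slin_Presburger.
- move=> [f fE]; apply: semilinear_MSO_definable => //.
  by apply/semilinear_slin/slin_qf; apply: qf_ext (qf_psat f) => v; rewrite fE.
Qed.
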